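(* Let $G=(V,E,w)$ be a connected edge-weighted graph with positive rational weights, at least two vertices, and maximum degree $\Delta$. The greedy algorithm applied to $U=V$ and the function $f=h+c$ returns a WPPICDS $S$ with $$|S|\le\Big(2+\ln\big(\tfrac32\cdot L\cdot W+\Delta\big)\Big)\cdot|S^*|,$$ where $S^*$ is a minimum-cardinality WPPICDS.
   Context: $N_A(v)=N(v)\cap A$, $W_A(v)=\sum_{u\in N_A(v)}w_{(v,u)}$, $W(v)=W_V(v)$, $W=\max_v W(v)$. $h(A)=\sum_{v\in V}h_A(v)$ with $h_A(v)=W(v)/2$ if $v\in A$ or $W_A(v)\ge W(v)/2$, and $h_A(v)=W_A(v)$ otherwise. For $v$ with incident edge weights $w_1,\dots,w_d$, write $w_0=W(v)/2$ and each $w_i$ as a reduced fraction $p_i/q_i$; $l(v)=\mathrm{lcm}\{q_0,\dots,q_d\}$, $L=\max_v l(v)$. $p(A)$ is the number of connected components of $G[A]$ ($p(\emptyset)=0$), $q(A)$ the number of connected components of the spanning subgraph $(V,\{e\in E: e\text{ has at least one endpoint in }A\})$, $c(A)=\frac1L(|V|-q(A)-p(A))$. The greedy algorithm: start with $S=\emptyset$; while some $u\in V\setminus S$ has $f(S\cup\{u\})-f(S)>0$, add to $S$ an element maximizing this increment (ties arbitrary); return $S$. A WPPICDS is a set $S\subseteq V$ such that every $v\in V\setminus S$ satisfies $W_S(v)\ge W(v)/2$ and $G[S]$ is connected. *)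

(* Defs.v *)
From HB Require Import structures.
From mathcomp Require Import all_boot all_order all_algebra.
From mathcomp Require Import reals exp.
Set Implicit Arguments. Unset Strict Implicit. Unset Printing Implicit Defensive.
Import Order.TTheory GRing.Theory Num.Theory.
Local Open Scope ring_scope.

Section Defs.
Variables (V : finType) (e : rel V) (w : V -> V -> rat).

Definition simple_graph := symmetric e /\ irreflexive e.
Definition pos_sym_weights :=
  forall u v, e u v -> w u v = w v u /\ 0 < w u v.
Definition graph_connected := forall x y : V, connect e x y.

Definition nbh (v : V) : {set V} := [set u | e v u].
Definition WA (A : {set V}) (v : V) : rat := \sum_(u in nbh v :&: A) w v u.
Definition Wv (v : V) : rat := WA [set: V] v.
Definition Wmax : rat := \big[Num.max/0]_(v : V) Wv v.
Definition Delta : nat := \max_(v : V) #|nbh v|.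

Definition hA (A : {set V}) (v : V) : rat :=
  if (v \in A) || (Wv v / 2%:R <= WA A v) then Wv v / 2%:R else WA A v.
Definition h (A : {set V}) : rat := \sum_(v : V) hA A v.

Definition lv (v : V) : nat :=
  lcmn `|denq (Wv v / 2%:R)|%N (\big[lcmn/1%N]_(u in nbh v) `|denq (w v u)|%N).
Definition Lmax : nat := \max_(v : V) lv v.

Definition induced_rel (A : {set V}) : rel V := [rel x y | [&& e x y, x \in A & y \in A]].
Definition pA (A : {set V}) : nat := n_comp (induced_rel A) (mem A).
Definition span_rel (A : {set V}) : rel V := [rel x y | e x y && ((x \in A) || (y \in A))].
Definition qA (A : {set V}) : nat := n_comp (span_rel A) (mem [set: V]).
Definition cA (A : {set V}) : rat :=
  (#|V|%:R - (qA A)%:R - (pA A)%:R) / (Lmax)%:R.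

Definition f (A : {set V}) : rat := h A + cA A.
Definition gain (S : {set V}) (u : V) : rat := f (u |: S) - f S.

(* A run of the greedy algorithm on U = V with ties broken arbitrarily:
   greedy_from S s  means that, starting from the current set S, the algorithm
   successively adds the elements of s (in order) and then stops. *)
Fixpoint greedy_from (S : {set V}) (s : seq V) : Prop :=
  match s with
  | [::] => forall u, u \notin S -> gain S u <= 0
  | x :: s' =>
      [/\ x \notin S, 0 < gain S x,
          (forall u, u \notin S -> gain S u <= gain S x)
        & greedy_from (x |: S) s']
  end.
Definition greedy_output (S : {set V}) : Prop :=
  exists s, greedy_from set0 s /\ S = [set x in s].

Definition is_WPPICDS (S : {set V}) : Prop :=
  (forall v, v \notin S -> Wv v / 2%:R <= WA S v) /\
  (forall x y, x \in S -> y \in S -> connect (induced_rel S) x y).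
Definition min_WPPICDS (S : {set V}) : Prop :=
  is_WPPICDS S /\ forall T, is_WPPICDS T -> (#|S| <= #|T|)%N.
End Defs.

(* Main.v *)
Require Import Defs.
From HB Require Import structures.
From mathcomp Require Import all_boot all_order all_algebra.
From mathcomp Require Import reals exp.
From mathcomp Require Import lra zify.
Import Order.TTheory GRing.Theory Num.Theory.
Local Open Scope ring_scope.

(* With L the constant [Lmax], greedy analysis of F = L f = L h + L c.

   Connected components are counted by [ncc]: adding an edge lowers the count
   by one exactly when it joins two components, so the drop caused by a fixed set
   of edges can only shrink when edges are added to the ambient graph. Hence -q is
   submodular, and -p fails submodularity by at most one when the ambient
   set is enlarged by a connected set Y, because all the edges from a new
   vertex to Y merge at most one further component. As h_A(v) is a modular
   function of A truncated at W(v)/2, h is submodular. Each h_A(v) is monotone in A and a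
   multiple of 1/l(v), so a positive gain of F is at least 1.

   If no gain is positive, the set is a WPPICDS, and every WPPICDS maximizes F
   over nonempty sets. Adding the t elements of an optimal T to the current set S
   in an order with connected prefixes gives, for the potential
   a = F_max - F(S) - (t - 1), the contraction a' <= a (1 - 1/t) at each step.
   Once a < t, the gap F_max - F(S) is below 2t - 1 and bounds the number of
   remaining steps. At S = set0 the same inequality gives
   a <= t max_y F({y}) <= t (3/2 L W + Delta). *)

(** * Connected components of symmetric relations and how edges merge them *)

Section Components.
Set Implicit Arguments.
Unset Strict Implicit.
Unset Printing Implicit Defensive.
Local Open Scope nat_scope.
Context {V : finType}.
Local Notation root := fingraph.root.
Implicit Types (r s : rel V) (a b x y : V).

(** Components are counted over the whole vertex type, so vertices without edges count as
    singletons. *)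
Definition ncc r : nat := #|roots r|.

Lemma connect_invariant {T : Type} r (g : V -> T) :
  (forall a b, r a b -> g a = g b) -> forall a b, connect r a b -> g a = g b.
Proof.
move=> gr a b /connectP[p]; elim: p a => [|c p IHp] a /=; first by move=> _ ->.
by case/andP=> /gr -> rp lp; apply: IHp.
Qed.

(** A map whose fibres are the components takes one value per component, so any choice of
    representatives can replace [root]. *)
Lemma ncc_section r (g : V -> V) : symmetric r ->
  (forall a b, (g a == g b) = connect r a b) -> ncc r = #|codom g|.
Proof.
move=> rS gP; have cS := sym_connect_sym rS.
have -> : #|codom g| = #|image g (roots r)|.
  apply: eq_card => z; apply/codomP/imageP => [[a ->]|[a _ ->]]; last by exists a.
  by exists (root r a); [apply: roots_root|apply/eqP; rewrite gP connect_root].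
rewrite card_in_image // => a b; rewrite !inE => /eqP ra /eqP rb gab.
by rewrite -ra -rb; apply/fingraph.rootP=> //; rewrite -gP gab.
Qed.

Lemma ncc_le r r' : symmetric r -> symmetric r' ->
  subrel r (connect r') -> ncc r' <= ncc r.
Proof.
move=> rS rS' rr'; have cS := sym_connect_sym rS; have cS' := sym_connect_sym rS'.
have {}rr' a b : connect r a b -> root r' a = root r' b.
  by apply: connect_invariant => {}a {}b /rr' /(fingraph.rootP cS').
apply: leq_trans (leq_image_card (root r') (roots r)).
apply: subset_leq_card; apply/subsetP => z zr; apply/imageP; exists (root r z).
  exact: roots_root.
by rewrite -(rr' _ _ (connect_root r z)); apply/esym/eqP.
Qed.

Lemma eq_ncc r r' : r =2 r' -> ncc r = ncc r'.
Proof.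
move=> rr'; apply: eq_card => x; rewrite !inE /fingraph.root.
by congr (_ == _); congr odflt; apply: eq_pick; apply: eq_connect.
Qed.

Definition add_edge r x y a b :=
  [|| r a b, (a == x) && (b == y) | (a == y) && (b == x)].

Lemma add_edge_sym r x y : symmetric r -> symmetric (add_edge r x y).
Proof.
move=> rS a b; rewrite /add_edge rS; congr (_ || _); rewrite orbC.
by congr (_ || _); rewrite andbC.
Qed.

Lemma ncc_add_edge r x y : symmetric r ->
  ncc r = ncc (add_edge r x y) + ~~ connect r x y.
Proof.
move=> rS; have cS := sym_connect_sym rS.
have rS' := @add_edge_sym r x y rS; have cS' := sym_connect_sym rS'.
(* Representatives for the enlarged graph: the component of [y] is redirected to the root of [x]. *)
pose g a := if connect r a y then root r x else root r a.
have sub a b : connect r a b -> connect (add_edge r x y) a b.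
  by apply: connect_sub => {}a {}b rab; apply: connect1; rewrite /add_edge rab.
have cxy : connect (add_edge r x y) x y by apply: connect1; rewrite /add_edge !eqxx orbT.
have cg a : connect (add_edge r x y) a (g a).
  rewrite /g; case: ifP => [ay|_]; last by apply: sub; apply: connect_root.
  apply: connect_trans (sub _ _ ay) _; rewrite cS' in cxy.
  by apply: connect_trans cxy _; apply: sub; apply: connect_root.
rewrite (@ncc_section (add_edge r x y) g) //; last first.
  move=> a b; apply/eqP/idP => [gab|].
    by apply: connect_trans (cg a) _; rewrite gab cS'.
  apply: connect_invariant => {}a {}b /or3P[rab||].
  - rewrite /g (same_connect cS (connect1 rab)).
    by case: ifP => // _; apply/fingraph.rootP => //; apply: connect1.
  - by case/andP=> /eqP -> /eqP ->; rewrite /g connect0; case: ifP.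
  - by case/andP=> /eqP -> /eqP ->; rewrite /g connect0; case: ifP.
case: (boolP (connect r x y)) => xy; rewrite /ncc.
  rewrite addn0; apply: eq_card => z; apply/idP/codomP => [zr|[a ->]].
    exists z; rewrite /g; case: ifP => [zy|_]; last by apply/esym/eqP.
    move/eqP: zr => {1}<-; apply/fingraph.rootP => //.
    by apply: connect_trans zy _; rewrite cS.
  by rewrite /g; case: ifP => _; apply: roots_root.
(* When [x] and [y] lie apart, [root r y] is the only root missed by [g]. *)
have yr : root r y \in roots r by apply: roots_root.
rewrite (cardD1 (root r y)) yr addnC; congr (_ + _).
apply: eq_card => z; rewrite !inE.
apply/andP/codomP => [[zy zr]|[a ->]].
  exists z; rewrite /g; case: ifP => [|_]; last by apply/esym/eqP.
  by move/(fingraph.rootP cS); rewrite (eqP zr) => E; rewrite E eqxx in zy.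
rewrite /g; case: ifP => [_|ay]; split; rewrite ?root_connect ?ay //.
  exact: roots_root.
exact: roots_root.
Qed.

(** The edge [x y] costs [r] one component, and the graph so obtained is still contained in the
    closure of [r']. *)
Lemma ncc_lt r r' x y : symmetric r -> symmetric r' ->
  subrel r (connect r') -> connect r' x y -> ~~ connect r x y -> ncc r' < ncc r.
Proof.
move=> rS rS' rr' xy' xy; rewrite (ncc_add_edge x y rS) xy addn1 ltnS.
have cS' := sym_connect_sym rS'.
apply: ncc_le => //; first exact: add_edge_sym.
move=> a b /or3P[/rr' //||] /andP[/eqP -> /eqP ->] //.
by rewrite cS'.
Qed.

(** The edges of [s] are added one by one: an edge that joins two components of the larger graph
    also joins two components of the smaller one. *)
Lemma ncc_relU_supermod r r' s : symmetric r -> symmetric r' -> symmetric s ->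
  subrel r (connect r') -> ncc r' + ncc (relU r s) <= ncc r + ncc (relU r' s).
Proof.
pose addl r l := foldr (fun p r => add_edge r p.1 p.2) r l.
have addlS l : forall r, symmetric r -> symmetric (addl r l).
  by elim: l => //= p l IHl {}r rS; apply: add_edge_sym; apply: IHl.
have addlP l : (forall a b, ((a, b) \in l) = ((b, a) \in l)) ->
    forall r a b, addl r l a b = r a b || ((a, b) \in l).
  move=> lS {}r a b.
  have : forall a b, addl r l a b = [|| r a b, ((a, b) \in l) | ((b, a) \in l)].
    elim: l {lS} => [|[x y] l IHl] c d; first by rewrite !in_nil !orbF.
    rewrite /= /add_edge IHl !inE !xpair_eqE [(d == x) && _]andbC.
    by case: (r c d); case: (_ && (d == y)); case: (_ && (d == x));
      case: ((c, d) \in l); case: ((d, c) \in l).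
  by move=> ->; rewrite -(lS a b) orbb.
(* The inclusion of closures goes through the induction with the inequality, since each new edge is
   tested in the current graphs. *)
have key l : forall r r', symmetric r -> symmetric r' -> subrel r (connect r') ->
   subrel (addl r l) (connect (addl r' l)) /\ ncc r' + ncc (addl r l) <= ncc r + ncc (addl r' l).
  move=> {}r {}r' rS rS' rr'; elim: l => [|[x y] l [IH1 IH2]] /=; first by split; rewrite // addnC.
  have S1 := addlS l _ rS; have S2 := addlS l _ rS'.
  split.
    have sub : subrel (addl r' l) (add_edge (addl r' l) x y) by move=> a b; rewrite /add_edge => ->.
    move=> a b /or3P[/IH1||].
    - by apply: connect_sub => c d /sub /connect1.
    - by move=> E; apply: connect1; rewrite /add_edge E orbT.
    - by move=> E; apply: connect1; rewrite /add_edge E !orbT.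
  have E1 := ncc_add_edge x y S1; have E2 := ncc_add_edge x y S2.
  have : connect (addl r l) x y -> connect (addl r' l) x y by apply: connect_sub.
  move: E1 E2; case: (connect (addl r l) x y); case: (connect (addl r' l) x y) => /= E1 E2 imp; lia.
move=> rS rS' sS rr'.
pose l := [seq p <- enum {: V * V} | s p.1 p.2].
have lE a b : ((a, b) \in l) = s a b by rewrite mem_filter mem_enum andbT.
have E r0 : ncc (relU r0 s) = ncc (addl r0 l).
  by apply: eq_ncc => a b; rewrite addlP ?lE // => c d; rewrite !lE.
by rewrite !E; have [] := key l _ _ rS rS' rr'.
Qed.

End Components.

(** * Effect of one new vertex on the connectivity term *)

Section ComponentGain.
Set Implicit Arguments.
Unset Strict Implicit.
Unset Printing Implicit Defensive.
Context {V : finType} (e : rel V).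
Hypotheses (eS : symmetric e) (eI : irreflexive e).
Implicit Types (A B Y S : {set V}) (x y u v : V).
Local Notation ind := (induced_rel e).
Local Notation spn := (span_rel e).
Local Notation root := fingraph.root.

(* L times the paper's c(A). *)
Definition cN A : rat := #|V|%:R - (qA e A)%:R - (pA e A)%:R.

(** The edges between [y] and [A], gained by [ind A] when [y] is added; with [setT] for [A], all
    edges at [y], gained by [spn]. *)
Definition star A y : rel V :=
  fun a b => e a b && ((a == y) && (b \in A) || (b == y) && (a \in A)).

Lemma indE A a b : ind A a b = [&& e a b, a \in A & b \in A].
Proof. by []. Qed.

Lemma spnE A a b : spn A a b = e a b && ((a \in A) || (b \in A)).
Proof. by []. Qed.

Definition graphE := (indE, spnE).

Lemma ind_sym A : symmetric (ind A).
Proof. by move=> a b; rewrite !graphE eS; congr (_ && _); rewrite andbC. Qed.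

Lemma spn_sym A : symmetric (spn A).
Proof. by move=> a b; rewrite !graphE eS; congr (_ && _); rewrite orbC. Qed.

Lemma star_sym A y : symmetric (star A y).
Proof. by move=> a b; rewrite /star eS; congr (_ && _); rewrite orbC. Qed.

Lemma ind_connect A B : A \subset B -> subrel (ind A) (connect (ind B)).
Proof.
move=> /subsetP AB a b /and3P[eab aA bA]; apply: connect1.
by rewrite /= !graphE /= eab !AB.
Qed.

Lemma spn_connect A B : A \subset B -> subrel (spn A) (connect (spn B)).
Proof.
move=> /subsetP AB a b /andP[eab /orP[]/AB aA]; apply: connect1.
  by rewrite /= !graphE /= eab aA.
by rewrite /= !graphE /= eab aA orbT.
Qed.

Lemma ind_setU1 A y : ind (y |: A) =2 relU (ind A) (star A y).
Proof.
move=> a b; rewrite /= !graphE /= /star !inE; case eab: (e a b) => //=.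
have : ~~ ((a == y) && (b == y)).
  by apply/negP => /andP[/eqP E1 /eqP E2]; rewrite E1 E2 eI in eab.
by case: (a == y); case: (b == y); case: (a \in A); case: (b \in A).
Qed.

Lemma spn_setU1 A y : spn (y |: A) =2 relU (spn A) (star setT y).
Proof.
move=> a b; rewrite /= !graphE /= /star !inE; case: (e a b) => //=.
by case: (a == y); case: (b == y); case: (a \in A); case: (b \in A).
Qed.

Lemma connect_isolated (r : rel V) x y :
  (forall z, ~~ r x z) -> connect r x y -> x = y.
Proof.
move=> rx /connectP[[|z p] //=].
by rewrite (negPf (rx z)).
Qed.

Lemma ind_connect_mem A x y : connect (ind A) x y -> (x \in A) = (y \in A).
Proof. by apply: (connect_invariant (g := fun a => a \in A)) => a b /and3P[_ -> ->]. Qed.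

Lemma qA_ncc A : qA e A = ncc (spn A).
Proof. by apply: eq_card => z; rewrite !inE /= andbT. Qed.

(** Every vertex outside [A] is isolated in [ind A] and forms a component of its own. *)
Lemma pA_ncc A : (pA e A + #|~: A|)%N = ncc (ind A).
Proof.
rewrite /ncc -(cardID (mem A) (roots (ind A))); congr (_ + _)%N; apply: eq_card => z.
rewrite !inE; case: (boolP (z \in A)) => //= zA.
apply/esym/eqP/esym; apply: (@connect_isolated (ind A)); last exact: connect_root.
by move=> u; rewrite indE (negPf zA) andbF.
Qed.

(** The [- 1] accounts for [y], which stops being one of the outside singletons that [ncc] counts
    and [pA] does not. *)
Lemma cN_setU1 A y : y \notin A -> cN (y |: A) - cN A =
  (ncc (spn A))%:R - (ncc (spn (y |: A)))%:R
  + ((ncc (ind A))%:R - (ncc (ind (y |: A)))%:R) - 1.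
Proof.
move=> yA; rewrite /cN !qA_ncc -!pA_ncc !natrD.
have : (#|y |: A| + #|~: (y |: A)| = #|A| + #|~: A|)%N by rewrite !cardsC.
rewrite cardsU1 yA /= => E.
have {E} : (#|~: A| = #|~: (y |: A)| + 1)%N by lia.
move=> ->; rewrite natrD; lra.
Qed.

Lemma ind_setU1_le A y : (ncc (ind (y |: A)) <= ncc (ind A))%N.
Proof.
by apply: ncc_le; [exact: ind_sym..|apply: ind_connect; apply: subsetUr].
Qed.

Lemma spn_setU1_le A y : (ncc (spn (y |: A)) <= ncc (spn A))%N.
Proof.
by apply: ncc_le; [exact: spn_sym..|apply: spn_connect; apply: subsetUr].
Qed.

Lemma ind_setU1_lt A y z : y \notin A -> z \in A -> e y z ->
  (ncc (ind (y |: A)) < ncc (ind A))%N.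
Proof.
move=> yA zA eyz; apply: (@ncc_lt _ _ _ y z); [exact: ind_sym..| | |].
- by apply: ind_connect; apply: subsetUr.
- by apply: connect1; rewrite /= !graphE /= eyz !inE eqxx zA orbT.
- by apply/negP => /ind_connect_mem; rewrite zA (negPf yA).
Qed.

Lemma spn_setU1_lt A y z : e y z -> ~~ connect (spn A) y z ->
  (ncc (spn (y |: A)) < ncc (spn A))%N.
Proof.
move=> eyz yz; apply: (@ncc_lt _ _ _ y z); [exact: spn_sym..| | |] => //.
- by apply: spn_connect; apply: subsetUr.
- by apply: connect1; rewrite /= !graphE /= eyz !inE eqxx.
Qed.

(** One strict drop compensates the [- 1] of [cN_setU1]: in [ind] if [y] has a neighbour in [A], and
    otherwise in [spn], where [y] was isolated. *)
Lemma cN_setU1_ge A y : (exists z, e y z) -> cN A <= cN (y |: A).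
Proof.
move=> [z0 eyz0]; case: (boolP (y \in A)) => [yA|yA].
  by rewrite (setUidPr _) // sub1set.
rewrite -subr_ge0 cN_setU1 //.
have := ind_setU1_le A y; have := spn_setU1_le A y.
suff : (ncc (ind (y |: A)) < ncc (ind A))%N || (ncc (spn (y |: A)) < ncc (spn A))%N.
  by case/orP => H1 H2 H3; rewrite -!(ler_nat rat) -?natr1 in H1 H2 H3; lra.
case: (boolP [exists z in A, e y z]) => [/exists_inP[z zA eyz]|].
  by rewrite (ind_setU1_lt yA zA).
rewrite negb_exists_in => /forall_inP Ny; rewrite (@spn_setU1_lt _ _ z0) ?orbT //.
apply/negP => /connect_isolated E; have : y = z0.
  apply: E => z; rewrite /= !graphE; apply/negP; rewrite (negPf yA) /= => /andP[eyz zA].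
  by move: (Ny z zA); rewrite eyz.
by move=> E'; rewrite -E' eI in eyz0.
Qed.

Lemma spn_submod A B y : A \subset B ->
  (ncc (spn B) + ncc (spn (y |: A)) <= ncc (spn A) + ncc (spn (y |: B)))%N.
Proof.
move=> AB; rewrite !(eq_ncc (spn_setU1 _ _)).
by apply: ncc_relU_supermod; [exact: spn_sym..|exact: star_sym|exact: spn_connect].
Qed.

(** Compared with [A], the ambient set [A :|: Y] gives [y] extra edges to [Y] only; [Y] lies in one
    component, so they merge at most one more, whence the [+ 1]. *)
Lemma ind_submod A Y y : {in Y &, forall a b, connect (ind Y) a b} ->
  (ncc (ind (A :|: Y)) + ncc (ind (y |: A))
     <= ncc (ind A) + ncc (ind (y |: (A :|: Y))) + 1)%N.
Proof.
move=> Yc; set B := A :|: Y.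
rewrite (eq_ncc (ind_setU1 A y)).
have := @ncc_relU_supermod _ (ind A) (ind B) (star A y) (@ind_sym A) (@ind_sym B)
  (@star_sym A y) (ind_connect (subsetUl _ _)).
suff : (ncc (relU (ind B) (star A y)) <= ncc (ind (y |: B)) + 1)%N by lia.
set r := relU _ _.
have rS : symmetric r by move=> a b; rewrite /r /= star_sym [induced_rel _ _ _ a]ind_sym.
have sub r' : subrel r r' -> subrel (ind B) (connect r').
  by move=> rr' a b H; apply: connect1; apply: rr'; rewrite /r /= in H *; rewrite H.
(* A single edge [y z] stands for all edges from [y] to [Y], because [Y] is connected inside
   [ind B]. *)
case: (boolP [exists z in Y, e y z]) => [/exists_inP[z zY eyz]|].
  rewrite (ncc_add_edge y z rS).
  suff : (ncc (add_edge r y z) <= ncc (ind (y |: B)))%N by case: (~~ _); lia.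
  have zS := @add_edge_sym _ r y z rS; have cS := sym_connect_sym zS.
  have rz : subrel r (add_edge r y z) by move=> a b; rewrite /add_edge => ->.
  have yz : connect (add_edge r y z) y z.
    by apply: connect1; rewrite /add_edge !eqxx orbT.
  have yb b : e y b -> b \in B -> connect (add_edge r y z) y b.
    move=> eyb; rewrite inE => /orP[bA|bY].
      by apply: connect1; apply: rz; rewrite /r /= /star eyb eqxx bA orbT.
    apply: connect_trans yz _; apply: connect_sub (Yc _ _ zY bY) => c d H.
    apply: sub rz _ _ _; move: H => /and3P[ecd cY dY].
    by rewrite /= !graphE /= ecd !inE cY dY !orbT.
  apply: ncc_le => //; first exact: ind_sym.
  move=> a b; rewrite ind_setU1 => /orP[H|]; first exact: sub rz _ _ H.
  case/andP=> eab /orP[]/andP[/eqP E H]; rewrite E in eab *; first exact: yb.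
  by rewrite cS; apply: yb; rewrite // eS.
rewrite negb_exists_in => /forall_inP Ny; apply: leq_trans (leq_addr _ _).
apply: ncc_le => //; first exact: ind_sym.
move=> a b; rewrite ind_setU1 => /orP[H|]; first by apply: sub H.
case/andP=> eab; rewrite !inE => H; apply: connect1; rewrite /r /= /star eab.
case/orP: H => /andP[/eqP E]; rewrite E in eab *; rewrite eqxx => /orP[->|zY].
- by rewrite orbT.
- by rewrite (negPf (Ny b zY)) in eab.
- by rewrite !orbT.
- by rewrite eS (negPf (Ny a zY)) in eab.
Qed.

Lemma cN_submod A Y y : (exists z, e y z) -> {in Y &, forall a b, connect (ind Y) a b} ->
  cN (y |: (A :|: Y)) - cN (A :|: Y) <= cN (y |: A) - cN A + 1.
Proof.
move=> ydeg Yc; case: (boolP (y \in A :|: Y)) => yAY.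
  rewrite [y |: _](setUidPr _) ?sub1set // subrr.
  by rewrite addr_ge0 // subr_ge0 cN_setU1_ge.
have yA : y \notin A by move: yAY; rewrite inE negb_or => /andP[].
rewrite !cN_setU1 //.
have := @spn_submod A (A :|: Y) y (subsetUl _ _); have := ind_submod A y Yc.
rewrite -!(ler_nat rat) !natrD; lra.
Qed.

Lemma cN_set0 : cN set0 = 0.
Proof.
have p0 : pA e set0 = 0%N by apply: eq_card0 => z; rewrite !inE andbF.
rewrite /cN p0 qA_ncc /ncc subr0 (_ : #|roots _| = #|V|) ?subrr //.
apply: eq_card => z; rewrite !inE; apply/eqP/esym; apply: (@connect_isolated (spn set0)).
  by move=> u; rewrite /= !graphE /= !inE andbF.
exact: connect_root.
Qed.

Lemma pA_gt0 A y : y \in A -> (0 < pA e A)%N.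
Proof.
move=> yA; have rA : root (ind A) y \in A.
  by rewrite -(ind_connect_mem (connect_root _ y)).
apply/card_gt0P; exists (root (ind A) y); rewrite inE /=; apply/andP; split=> //.
by apply: roots_root; apply: (sym_connect_sym (@ind_sym _)).
Qed.

(** Vertices other than [y] and its neighbours stay isolated in [spn [set y]], which bounds [qA]
    below; the remaining 1, for [y] itself, is absorbed by [pA]. *)
Lemma cN_set1 y : cN [set y] <= #|nbh e y|%:R.
Proof.
have pos := pA_gt0 (set11 y).
suff q : (#|V| <= qA e [set y] + #|nbh e y| + 1)%N.
  rewrite /cN; have {}q : (#|V| <= qA e [set y] + #|nbh e y| + pA e [set y])%N by lia.
  by move: q; rewrite -(ler_nat rat) !natrD; lra.
rewrite qA_ncc -(cardsC (y |: nbh e y)).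
have := cardsU1 y (nbh e y); rewrite inE eI /= => ->.
suff : (#|~: (y |: nbh e y)| <= ncc (spn [set y]))%N by lia.
apply: subset_leq_card; apply/subsetP => z; rewrite !inE negb_or => /andP[zy eyz].
apply/eqP/esym; apply: (@connect_isolated (spn [set y])); last exact: connect_root.
move=> u; rewrite /= !graphE /= !inE (negPf zy) /=; apply/negP => /andP[ezu /eqP uy].
by rewrite -uy eS ezu in eyz.
Qed.

Lemma cN_le S : S != set0 -> cN S <= #|V|%:R - 2.
Proof.
case/set0Pn => y yS.
have pos := pA_gt0 yS.
have qpos : (0 < qA e S)%N.
  rewrite qA_ncc; apply/card_gt0P; exists (root (spn S) y).
  by apply: roots_root; apply: (sym_connect_sym (@spn_sym _)).
by move: pos qpos; rewrite -!(ler_nat rat) /cN; lra.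
Qed.

(** Connectedness gives [pA <= 1] and domination then gives [qA <= 1], so the upper bound of [cN_le]
    is attained. *)
Lemma cN_connected_dominating S : {in S &, forall a b, connect (ind S) a b} ->
  (forall v, v \notin S -> exists2 u, u \in S & e v u) -> #|V|%:R - 2 <= cN S.
Proof.
move=> Sc Sdom.
have p1 : (pA e S <= 1)%N.
  apply/card_le1P => a; rewrite inE /= => /andP[/eqP ra aS] b; rewrite !inE /=.
  apply/andP/eqP => [[/eqP rb bS]|->]; last by split=> //; apply/eqP.
  rewrite -ra -rb; apply/esym/fingraph.rootP; first exact: (sym_connect_sym (@ind_sym _)).
  exact: Sc.
have cS := sym_connect_sym (@spn_sym S).
have spS a b : a \in S -> b \in S -> connect (spn S) a b.
  move=> aS bS; apply: connect_sub (Sc _ _ aS bS) => c d /and3P[ecd cS' _].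
  by apply: connect1; rewrite /= !graphE /= ecd cS'.
have toS a : exists2 u, u \in S & connect (spn S) a u.
  case: (boolP (a \in S)) => [aS|/Sdom[u uS eau]]; first by exists a.
  by exists u => //; apply: connect1; rewrite /= !graphE /= eau uS orbT.
have q1 : (qA e S <= 1)%N.
  rewrite qA_ncc; apply/card_le1P => a; rewrite inE /= => /eqP ra b; rewrite !inE /=.
  apply/idP/eqP => [/eqP rb|->]; last by apply/eqP.
  rewrite -ra -rb; apply/esym/fingraph.rootP => //.
  have [u uS au] := toS a; have [v vS bv] := toS b.
  by apply: connect_trans au _; apply: connect_trans (spS _ _ uS vS) _; rewrite cS.
by move: p1 q1; rewrite -!(ler_nat rat) /cN; lra.
Qed.

Lemma crossing_edge (K : pred V) x y : connect e x y -> K x -> ~~ K y ->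
  exists u v, [/\ e u v, K u & ~~ K v].
Proof.
move=> xy Kx Ky.
case: (boolP [exists u, exists v, [&& e u v, K u & ~~ K v]]).
  by move=> /existsP[u /existsP[v /and3P[]]]; exists u, v.
rewrite negb_exists => /forallP N; suff E : K x = K y by rewrite -E Kx in Ky.
apply: (connect_invariant (g := K)) xy => a b eab; apply/idP/idP => [Ka|Kb].
  by have := N a; rewrite negb_exists => /forallP/(_ b); rewrite eab Ka negbK.
by have := N b; rewrite negb_exists => /forallP/(_ a); rewrite eS eab Kb negbK.
Qed.

(** The vertex [u] merges with two distinct components of [ind S], so [ncc] drops by at least two,
    one more than the [- 1] of [cN_setU1]. *)
Lemma cN_setU1_gt_of_bridge S u x a b : u \notin S -> a \in S -> b \in S ->
  e u a -> e u b -> connect (ind S) x a -> ~~ connect (ind S) x b ->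
  cN S < cN (u |: S).
Proof.
move=> uS aS bS eua eub xa xb.
rewrite -subr_gt0 cN_setU1 //; have := spn_setU1_le S u.
suff : (ncc (ind (u |: S)) + 1 < ncc (ind S))%N.
  by rewrite -!(ler_nat rat) -!natr1 natrD; lra.
have ua : ~~ connect (ind S) u a.
  by apply/negP => /ind_connect_mem; rewrite aS (negPf uS).
rewrite (ncc_add_edge u a (ind_sym S)) ua ltn_add2r.
apply: (@ncc_lt _ _ _ u b); [exact/add_edge_sym/ind_sym|exact: ind_sym| | |].
- move=> c d /or3P[H||].
  + by apply: (@ind_connect S); rewrite ?subsetUr.
  + by case/andP=> /eqP -> /eqP ->; apply: connect1; rewrite indE eua !inE eqxx aS orbT.
  + by case/andP=> /eqP -> /eqP ->; apply: connect1; rewrite indE eS eua !inE eqxx aS orbT.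
- by apply: connect1; rewrite indE eub !inE eqxx bS orbT.
(* An invariant of the graph with the edge [u a] that separates [u] from [b]. *)
pose g z := (z == u) || connect (ind S) x z.
have neu z : z \in S -> (z == u) = false.
  by move=> zS; apply/negP => /eqP E; rewrite -E zS in uS.
suff gE c d : add_edge (ind S) u a c d -> g c = g d.
  by apply/negP => /(connect_invariant gE); rewrite /g eqxx (negPf xb) neu.
rewrite /g => /or3P[H||].
- rewrite (same_connect_r (sym_connect_sym (@ind_sym S)) (connect1 H)).
  by case/and3P: H => _ /neu -> /neu ->.
- by case/andP=> /eqP -> /eqP ->; rewrite eqxx xa orbT.
- by case/andP=> /eqP -> /eqP ->; rewrite eqxx xa orbT.
Qed.

(** If no outside vertex bridges two components of [ind S], the component of [x] with its neighbours
    is closed under [spn S]. An edge leaving it joins two components of [spn S], and its inner end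
    [u] also has a neighbour in [S]: two drops against the [- 1]. *)
Lemma cN_setU1_gt_of_disconnected S x y : (forall a b, connect e a b) ->
  (forall v, v \notin S -> exists2 u, u \in S & e v u) ->
  x \in S -> y \in S -> ~~ connect (ind S) x y ->
  exists2 u, u \notin S & cN S < cN (u |: S).
Proof.
move=> ec Sdom xS yS xy.
have cS := sym_connect_sym (@ind_sym S).
case: (boolP [exists u, exists a, exists b, [&& u \notin S, a \in S, b \in S,
   e u a & [&& e u b, connect (ind S) x a & ~~ connect (ind S) x b]]]).
  move=> /existsP[u /existsP[a /existsP[b /and5P[uS aS bS eua /and3P[eub xa xb]]]]].
  by exists u => //; apply: (@cN_setU1_gt_of_bridge _ _ x a b).
move=> N; have {}N u a b : u \notin S -> a \in S -> b \in S -> e u a -> e u b ->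
    connect (ind S) x a -> connect (ind S) x b.
  move=> uS aS bS eua eub xa; apply/negPn/negP => xb; case/negP: N.
  apply/existsP; exists u; apply/existsP; exists a; apply/existsP; exists b.
  by rewrite uS aS bS eua eub xa xb.
pose cl a := (a \in S) && connect (ind S) x a.
pose K z := cl z || [exists a, cl a && e z a].
have clS a b : cl a -> e a b -> b \in S -> cl b.
  move=> /andP[aS xa] eab bS; rewrite /cl bS; apply: connect_trans xa _.
  by apply: connect1; rewrite indE eab aS.
have KS b : K b -> b \in S -> cl b.
  by move=> /orP[//|/existsP[a /andP[ca eba]]] bS; apply: (clS a); rewrite // eS.
have Ke a b : cl a -> e b a -> K b.
  by move=> ca eba; apply/orP; right; apply/existsP; exists a; rewrite ca.
have Kx : K x by rewrite /K /cl xS connect0.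
have Ky : ~~ K y.
  by apply/negP => /KS/(_ yS) /andP[_]; apply/negP.
have Kspn a b : spn S a b -> K a -> K b.
  case/andP=> eab /orP[aS Ka|bS].
    by apply: (Ke a); rewrite 1?eS // KS.
  case/orP=> [ca|/existsP[c /andP[/andP[cS' xc] eac]]].
    by rewrite /K (clS a).
  case: (boolP (a \in S)) => aS.
    rewrite /K (clS a) // /cl aS; apply: connect_trans xc _.
    by apply: connect1; rewrite indE eS eac cS' aS.
  (* Here [a] is an outside vertex adjacent to the component of [x]; as it is no bridge, its
     neighbour [b] in [S] belongs to that component. *)
  by rewrite /K /cl bS (N a c b).
have [u [v [euv Ku Kv]]] := crossing_edge (ec x y) Kx Ky.
have uS : u \notin S.
  by apply/negP => uS; case/negP: Kv; apply: (Ke u); rewrite 1?eS // KS.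
exists u => //; have [z zS euz] := Sdom u uS.
rewrite -subr_gt0 cN_setU1 //.
have := ind_setU1_lt uS zS euz.
have : (ncc (spn (u |: S)) < ncc (spn S))%N.
  apply: (spn_setU1_lt euv); apply/negP => /(connect_invariant (g := K)) E.
  case/negP: Kv; rewrite -E // => a b ab; apply/idP/idP; apply: Kspn => //.
  by rewrite spn_sym.
by rewrite -!(ler_nat rat) -!natr1; lra.
Qed.

End ComponentGain.

(** * Integrality and truncation of rationals *)

Lemma natr_mul_denq_int (q : rat) (n : nat) : (`|denq q| %| n)%N ->
  n%:R * q \is a Num.int.
Proof.
case/dvdnP => k ->; rewrite natrM -mulrA; apply: rpredM; first exact: rpred_nat.
have -> : `|denq q|%N%:R * q = (numq q)%:~R.
  by rewrite numqE mulrC; congr (_ * _); rewrite pmulrn absz_denq.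
exact: intr_int.
Qed.

Lemma int_gt0_ge1 (x : rat) : x \is a Num.int -> 0 < x -> 1 <= x.
Proof. by move/intrP => [m ->]; rewrite ltr0z ler1z gtz0_ge1. Qed.

(** Truncation at [k] is concave: the same increment has less effect from a higher start. *)
Lemma min_concave (k a b g : rat) : a <= b -> 0 <= g ->
  Num.min k (g + b) - Num.min k b <= Num.min k (g + a) - Num.min k a.
Proof.
by move=> ab g0; case: (leP k (g + b)); case: (leP k b); case: (leP k (g + a));
  case: (leP k a); lra.
Qed.

(** * Monotonicity, submodularity and gaps of the coverage term *)

Section CoverageGain.
Set Implicit Arguments.
Unset Strict Implicit.
Unset Printing Implicit Defensive.
Context {V : finType} (e : rel V) (w : V -> V -> rat).
Hypotheses (eS : symmetric e) (eI : irreflexive e) (wP : pos_sym_weights e w).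
Implicit Types (A B : {set V}) (x y u v : V).
Local Notation Wv := (Wv e w).
Local Notation WA := (WA e w).
Local Notation hA := (hA e w).
Local Notation h := (h e w).
Local Notation Lmax := (Lmax e w).
Local Notation lv := (lv e w).

(* The weight W(v)/2 of v itself makes the truncation at W(v)/2 automatic when v \in A. *)
Definition wt v u : rat :=
  if u == v then Wv v / 2 else if e v u then w v u else 0.

Definition mW A v : rat := \sum_(u in A) wt v u.

Lemma WA_ge0 A v : 0 <= WA A v.
Proof.
apply: sumr_ge0 => u; rewrite !inE => /andP[evu _].
by have [_ /ltW] := wP evu.
Qed.

Lemma Wv_gt0 v : (exists u, e v u) -> 0 < Wv v.
Proof.
move=> [u evu]; rewrite /Defs.Wv /Defs.WA (bigD1 u) ?inE ?evu //=.
apply: ltr_pwDl; first by have [_] := wP evu.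
apply: sumr_ge0 => z; rewrite !inE => /andP[/andP[evz _] _].
by have [_ /ltW] := wP evz.
Qed.

Lemma wt_ge0 v u : 0 <= wt v u.
Proof.
rewrite /wt; case: ifP => _; first by rewrite divr_ge0 // WA_ge0.
by case: ifP => // evu; have [_ /ltW] := wP evu.
Qed.

Lemma mW_setU1 A y v : y \notin A -> mW (y |: A) v = wt v y + mW A v.
Proof. by move=> yA; rewrite /mW big_setU1. Qed.

Lemma mW_sub A B v : A \subset B -> mW A v <= mW B v.
Proof.
move=> AB; rewrite /mW [leRHS](big_setID A) /= (setIidPr AB) lerDl.
by apply: sumr_ge0 => u _; apply: wt_ge0.
Qed.

Lemma mW_notin A v : v \notin A -> mW A v = WA A v.
Proof.
move=> vA; rewrite /mW /Defs.WA.
rewrite (eq_bigr (fun u => if e v u then w v u else 0)) => [|u uA].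
  rewrite -big_mkcondr; apply: eq_bigl => u; by rewrite !inE andbC.
by rewrite /wt; case: eqP => // uv; rewrite -uv uA in vA.
Qed.

Lemma hA_min A v : hA A v = Num.min (Wv v / 2) (mW A v).
Proof.
rewrite /Defs.hA; case: (boolP (v \in A)) => [vA|vA] /=.
  apply/esym/min_idPl; rewrite /mW (bigD1 v) //= /wt eqxx lerDl.
  by apply: sumr_ge0 => u _; apply: wt_ge0.
by rewrite mW_notin //; case: leP.
Qed.

Lemma hA_setU1_ge A y v : hA A v <= hA (y |: A) v.
Proof.
rewrite !hA_min le_min2 //; apply: mW_sub; exact: subsetUr.
Qed.

Lemma hA_submod A B y v : A \subset B ->
  hA (y |: B) v - hA B v <= hA (y |: A) v - hA A v.
Proof.
move=> AB; case: (boolP (y \in B)) => yB.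
  by rewrite (setUidPr _) ?sub1set // subrr subr_ge0 hA_setU1_ge.
have yA : y \notin A by apply: contra yB; apply: (subsetP AB).
by rewrite !hA_min !mW_setU1 //; apply: min_concave; [apply: mW_sub|apply: wt_ge0].
Qed.

Lemma lv_gt0 v : (0 < lv v)%N.
Proof.
rewrite /Defs.lv lcmn_gt0 absz_gt0 denq_neq0 /=.
elim/big_ind: _ => // [a b a0 b0|u _]; first by rewrite lcmn_gt0 a0.
by rewrite absz_gt0 denq_neq0.
Qed.

Lemma lv_le_Lmax v : (lv v <= Lmax)%N.
Proof. exact: (leq_bigmax v). Qed.

Lemma hA_int A v : (lv v)%:R * hA A v \is a Num.int.
Proof.
rewrite /Defs.hA; case: ifP => _.
  by apply: natr_mul_denq_int; apply: dvdn_lcml.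
rewrite mulr_sumr; apply: rpred_sum => u; rewrite !inE => /andP[evu _].
apply: natr_mul_denq_int; apply: dvdn_trans (dvdn_lcmr _ _).
by apply: (biglcmn_sup u); rewrite // inE.
Qed.

(** Integrality is used with [lv v] only; the increment being positive, the comparison
    [lv v <= Lmax] then suffices and no divisibility of [Lmax] is involved. *)
Lemma hA_setU1_gap A y v : hA A v < hA (y |: A) v ->
  1 <= Lmax%:R * (hA (y |: A) v - hA A v).
Proof.
rewrite -subr_gt0 => d0.
apply: (@le_trans _ _ ((lv v)%:R * (hA (y |: A) v - hA A v))).
  apply: int_gt0_ge1; first by rewrite mulrBr rpredB ?hA_int.
  by rewrite mulr_gt0 // ltr0n lv_gt0.
by rewrite ler_pM2r // ler_nat lv_le_Lmax.
Qed.

Lemma h_setU1_ge A y : h A <= h (y |: A).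
Proof. by apply: ler_sum => v _; apply: hA_setU1_ge. Qed.

Lemma h_submod A B y : A \subset B -> h (y |: B) - h B <= h (y |: A) - h A.
Proof.
move=> AB; rewrite /Defs.h -!sumrB.
by apply: ler_sum => v _; apply: hA_submod.
Qed.

Lemma h_setU1_gt A y v : hA A v < hA (y |: A) v -> h A < h (y |: A).
Proof.
move=> lt; rewrite /Defs.h (bigD1 v) // [ltRHS](bigD1 v) //=.
by apply: ltr_leD => //; apply: ler_sum => u _; apply: hA_setU1_ge.
Qed.

Lemma h_setU1_gap A y : h A < h (y |: A) -> 1 <= Lmax%:R * (h (y |: A) - h A).
Proof.
move=> lt; case: (boolP [exists v, hA A v < hA (y |: A) v]) => [/existsP[v lv]|].
  apply: le_trans (hA_setU1_gap lv) _; apply: ler_wpM2l => //.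
  rewrite /Defs.h -sumrB (bigD1 v) //= lerDl; apply: sumr_ge0 => u _.
  by rewrite subr_ge0 hA_setU1_ge.
rewrite negb_exists => /forallP N; move: lt; rewrite ltNge.
by rewrite (@ler_sum _ _ _ _ (hA (y |: A))) // => v _; rewrite leNgt N.
Qed.

Lemma h_set0 : h set0 = 0.
Proof.
rewrite /Defs.h big1 // => v _; rewrite hA_min /mW big_set0; apply/min_idPr.
by rewrite divr_ge0 // WA_ge0.
Qed.

Lemma Wv_le_Wmax v : Wv v <= Wmax e w.
Proof. exact: le_bigmax. Qed.

(** The vertex [y] contributes half of [Wv y] for itself, and its neighbours receive at most [Wv y]
    in total, by symmetry of the weights. *)
Lemma h_set1 y : h [set y] <= 3 / 2 * Wmax e w.
Proof.
apply: (@le_trans _ _ (\sum_v wt v y)).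
  by apply: ler_sum => v _; rewrite hA_min ge_min /mW big_set1 lexx orbT.
rewrite (bigD1 y) //= {1}/wt eqxx.
have -> : \sum_(v | v != y) wt v y = Wv y.
  rewrite /Defs.Wv /Defs.WA big_mkcond [RHS]big_mkcond /=; apply: eq_bigr => v _.
  rewrite !inE andbT /wt [y == v]eq_sym; case: eqP => [->|_] /=; first by rewrite eI.
  by rewrite eS; case: ifP => // evy; have [->] := wP evy.
by have := Wv_le_Wmax y; lra.
Qed.

Lemma h_le A : h A <= \sum_v Wv v / 2.
Proof. by apply: ler_sum => v _; rewrite hA_min ge_min lexx. Qed.

Lemma h_covering A : (forall v, v \notin A -> Wv v / 2 <= WA A v) ->
  h A = \sum_v Wv v / 2.
Proof.
move=> Acov; apply: eq_bigr => v _; rewrite /Defs.hA.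
by case: (boolP (v \in A)) => //= /Acov ->.
Qed.

Lemma h_setU1_gt_of_uncovered A v : v \notin A -> WA A v < Wv v / 2 ->
  h A < h (v |: A).
Proof.
move=> vA lt; apply: (@h_setU1_gt _ _ v).
by rewrite /Defs.hA setU11 /= (negPf vA) /= leNgt lt.
Qed.

End CoverageGain.

(** * Gains of the greedy algorithm compared with a connected target set *)

Section Greedy.
Set Implicit Arguments.
Unset Strict Implicit.
Unset Printing Implicit Defensive.
Context {V : finType} (e : rel V) (w : V -> V -> rat).
Hypotheses (eS : symmetric e) (eI : irreflexive e) (wP : pos_sym_weights e w).
Hypotheses (ec : graph_connected e) (V2 : (1 < #|V|)%N).
Implicit Types (A B S T Y : {set V}) (x y u v : V) (s : seq V).
Local Notation ind := (induced_rel e).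
Local Notation cN := (cN e).
Local Notation f := (f e w).
Local Notation h := (h e w).
Local Notation gain := (gain e w).
Local Notation lam := ((Lmax e w)%:R : rat).

Lemma neighbour_exists v : exists z, e v z.
Proof.
have [y yv] : exists y, y != v.
  have : (0 < #|~: [set v]|)%N by rewrite cardsC1; case: #|V| V2 => // -[].
  by case/card_gt0P => y; rewrite !inE; exists y.
case/connectP: (ec v y) => -[/= _ E|z p /= /andP[evz _] _]; last by exists z.
by rewrite E eqxx in yv.
Qed.

Lemma lam_gt0 : 0 < lam.
Proof.
have /card_gt0P[v _] : (0 < #|V|)%N by apply: leq_trans V2.
by rewrite ltr0n (leq_trans (lv_gt0 e w v)) // lv_le_Lmax.
Qed.

Lemma lam_f A : lam * f A = lam * h A + cN A.
Proof. by rewrite mulrDr mulrC [lam * cA _ _ _]mulrC divfK // gt_eqF // lam_gt0. Qed.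

Lemma lam_gain A y : lam * gain A y =
  lam * (h (y |: A) - h A) + (cN (y |: A) - cN A).
Proof. by rewrite /Defs.gain mulrBr !lam_f; lra. Qed.

Lemma gain_in A y : y \in A -> gain A y = 0.
Proof. by move=> yA; rewrite /Defs.gain (setUidPr _) ?sub1set // subrr. Qed.

Lemma gain_ge0 A y : 0 <= gain A y.
Proof.
rewrite -(pmulr_rge0 _ lam_gt0) lam_gain addr_ge0 //.
  by rewrite mulr_ge0 // subr_ge0 h_setU1_ge.
by rewrite subr_ge0 cN_setU1_ge //; apply: neighbour_exists.
Qed.

(** Either [h] is unchanged and the scaled gain is an integer difference of [cN], or [h] alone
    contributes at least 1 while [cN] does not decrease. *)
Lemma gain_gap A y : 0 < gain A y -> 1 <= lam * gain A y.
Proof.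
rewrite -(pmulr_rgt0 _ lam_gt0) lam_gain.
have := cN_setU1_ge eS eI A (neighbour_exists y).
have := h_setU1_ge wP A y.
rewrite le_eqVlt => /predU1P[<-|/(h_setU1_gap wP) hlt]; last by lra.
rewrite subrr mulr0 !add0r => _; apply: int_gt0_ge1.
by rewrite /cN !(rpredB, rpred_nat).
Qed.

Lemma gain_submod A Y y : {in Y &, forall a b, connect (ind Y) a b} ->
  lam * gain (A :|: Y) y <= lam * gain A y + 1.
Proof.
move=> Yc; rewrite !lam_gain.
have := cN_submod eS eI A (neighbour_exists y) Yc.
have := h_submod wP y (subsetUl A Y).
by rewrite -(ler_pM2l lam_gt0); lra.
Qed.

Lemma f_le A B : A \subset B -> f A <= f B.
Proof.
have [n] := ubnP #|B :\: A|; elim: n A => // n IHn A lt AB.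
have [E|/set0Pn[y]] := eqVneq (B :\: A) set0.
  by rewrite (_ : A = B) //; apply/eqP; rewrite eqEsubset AB -setD_eq0 E eqxx.
rewrite inE => /andP[yA yB].
apply: (@le_trans _ _ (f (y |: A))); first by rewrite -subr_ge0 gain_ge0.
apply: IHn; last by rewrite subUset sub1set yB.
by move: lt; rewrite (cardsD1 y) inE yA yB setDDl setUC.
Qed.

(** An edge of [ind T] leaving [Y] supplies [y]; iterating this orders [T] with connected
    prefixes. *)
Lemma connected_extension T Y : {in T &, forall a b, connect (ind T) a b} ->
  {in Y &, forall a b, connect (ind Y) a b} -> Y \proper T -> Y != set0 ->
  exists y, [/\ y \in T, y \notin Y &
    {in y |: Y &, forall a b, connect (ind (y |: Y)) a b}].
Proof.
move=> Tc Yc /properP[YT [z zT zY]] /set0Pn[x xY].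
have xT := subsetP YT _ xY.
have [a [y [/and3P[eay aT yT] aY yY]]] :=
  crossing_edge (K := fun v => v \in Y) (@ind_sym _ _ eS T) (Tc _ _ xT zT) xY zY.
exists y; split=> //.
have cS := sym_connect_sym (@ind_sym _ _ eS (y |: Y)).
suff toa b : b \in y |: Y -> connect (ind (y |: Y)) a b.
  by move=> b c bY cY; apply: connect_trans (toa c cY); rewrite cS toa.
rewrite !inE => /predU1P[->|bY].
  by apply: connect1; rewrite indE eay !inE aY eqxx orbT.
by apply: connect_sub (Yc _ _ aY bY); apply: ind_connect; apply: subsetUr.
Qed.

Lemma f_extension_le A T Y : {in T &, forall a b, connect (ind T) a b} ->
  {in Y &, forall a b, connect (ind Y) a b} -> Y \subset T -> Y != set0 ->
  lam * (f (A :|: T) - f (A :|: Y)) <= \sum_(y in T :\: Y) (lam * gain A y + 1).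
Proof.
move=> Tc; have [n] := ubnP #|T :\: Y|; elim: n Y => // n IHn Y lt Yc YT Y0.
have [E|neq] := eqVneq Y T.
  by rewrite E subrr mulr0 setDv big_set0.
have YpT : Y \proper T by rewrite properEneq neq YT.
have [y [yT yY yYc]] := connected_extension Tc Yc YpT Y0.
have yTY : y \in T :\: Y by rewrite inE yT yY.
have DE : (T :\: Y) :\ y = T :\: (y |: Y) by rewrite setDDl setUC.
have {}lt : (#|T :\: (y |: Y)| < n)%N by move: lt; rewrite (cardsD1 y) yTY DE.
have sub : y |: Y \subset T by rewrite subUset sub1set yT.
have ne : y |: Y != set0 by apply/set0Pn; exists y; rewrite setU11.
have := IHn _ lt yYc sub ne; rewrite (big_setD1 y yTY) /= DE.
have := gain_submod A y Yc; rewrite /(gain (A :|: Y) y) setUCA.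
by rewrite !mulrBr; lra.
Qed.

(** The first element of [T] is added to [A] itself and incurs no defect, whence [#|T| - 1] rather
    than [#|T|]. *)
Lemma f_setU_connected_le A T : {in T &, forall a b, connect (ind T) a b} ->
  T != set0 ->
  lam * (f (A :|: T) - f A) <= \sum_(y in T) (lam * gain A y) + (#|T|%:R - 1).
Proof.
move=> Tc /set0Pn[y yT].
have yc : {in [set y] &, forall a b, connect (ind [set y]) a b}.
  by move=> a b /set1P -> /set1P ->.
have y0 : [set y] != set0 by apply/set0Pn; exists y; rewrite set11.
have yT' : [set y] \subset T by rewrite sub1set.
have := f_extension_le A Tc yc yT' y0.
rewrite big_split /= (big_setD1 y yT) /= sumr_const (cardsD1 y T) yT natrD.
by rewrite /(gain A y) [A :|: [set y]]setUC /= !mulrBr; lra.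
Qed.

Lemma covering_dominating T : (forall v, v \notin T -> Wv e w v / 2 <= WA e w T v) ->
  forall v, v \notin T -> exists2 u, u \in T & e v u.
Proof.
move=> cov v vT; have [E|/set0Pn[u]] := eqVneq (nbh e v :&: T) set0; last first.
  by rewrite !inE => /andP[evu uT]; exists u.
have := cov v vT; rewrite {1}/WA E big_set0.
by have := Wv_gt0 wP (neighbour_exists v); lra.
Qed.

Lemma WPPICDS_neq0 T : is_WPPICDS e w T -> T != set0.
Proof.
move=> wT; have /card_gt0P[v _] : (0 < #|V|)%N by apply: leq_trans V2.
case: (boolP (v \in T)) => [vT|/(covering_dominating wT.1)[u uT _]].
  by apply/set0Pn; exists v.
by apply/set0Pn; exists u.
Qed.

(** At [T] both summands attain their upper bounds, [h_le] and [cN_le]. *)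
Lemma f_le_WPPICDS S T : is_WPPICDS e w T -> S != set0 -> f S <= f T.
Proof.
move=> wT S0; rewrite -(ler_pM2l lam_gt0) !lam_f.
apply: lerD; last first.
  apply: le_trans (cN_le eS S0) _.
  apply: cN_connected_dominating => //; first by case: wT.
  exact: covering_dominating wT.1.
rewrite ler_pM2l ?lam_gt0 // (h_covering (A := T)); last by case: wT.
exact: h_le.
Qed.

(** An uncovered vertex would raise [h], and a covering but disconnected set could be enlarged to
    raise [cN]; the other summand never drops. *)
Lemma WPPICDS_of_no_gain S : (forall u, u \notin S -> gain S u <= 0) ->
  is_WPPICDS e w S.
Proof.
move=> noG.
have gain0 u : u \notin S -> lam * gain S u <= 0.
  by move=> /noG; rewrite pmulr_rle0 // lam_gt0.
have cov v : v \notin S -> Wv e w v / 2 <= WA e w S v.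
  move=> vS; rewrite leNgt; apply/negP => /(h_setU1_gt_of_uncovered wP vS).
  have := gain0 v vS; rewrite lam_gain.
  have := cN_setU1_ge eS eI S (neighbour_exists v).
  by rewrite -subr_gt0 -(pmulr_rgt0 _ lam_gt0); lra.
split=> // x y xS yS; apply/negPn/negP => xy.
have dom := covering_dominating cov.
have [u uS] := cN_setU1_gt_of_disconnected eS ec dom xS yS xy.
have := gain0 u uS; rewrite lam_gain.
have := h_setU1_ge wP S u.
by rewrite -subr_ge0 -(pmulr_rge0 _ lam_gt0); lra.
Qed.

Lemma greedy_final_cons S x s : S :|: [set z in x :: s] = (x |: S) :|: [set z in s].
Proof. by rewrite set_cons setUCA setUA. Qed.

Lemma greedy_from_WPPICDS S s : greedy_from e w S s ->
  is_WPPICDS e w (S :|: [set z in s]).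
Proof.
elim: s S => [|x s IHs] S /=.
  by rewrite set_nil setU0; apply: WPPICDS_of_no_gain.
by case=> _ _ _ /IHs; rewrite greedy_final_cons.
Qed.

Lemma greedy_size_le S s : greedy_from e w S s ->
  (size s)%:R <= lam * (f (S :|: [set z in s]) - f S).
Proof.
elim: s S => [|x s IHs] S /=; first by rewrite set_nil setU0 subrr mulr0.
case=> _ /gain_gap gx _ /IHs; rewrite greedy_final_cons -natr1.
by move: gx; rewrite /Defs.gain !mulrBr; lra.
Qed.

(** The gain of [x] dominates that of every element of [T], those already in [S] having gain 0; the
    value of the final set is at most that of [T], hence of [S :|: T]. *)
Lemma greedy_step_progress S s T x : is_WPPICDS e w T ->
  greedy_from e w S (x :: s) ->
  lam * (f (S :|: [set z in x :: s]) - f S) - (#|T|%:R - 1)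
    <= #|T|%:R * (lam * gain S x).
Proof.
move=> wT gs; have T0 := WPPICDS_neq0 wT.
have F0 := WPPICDS_neq0 (greedy_from_WPPICDS gs).
have := f_setU_connected_le S wT.2 T0.
have fT : f (S :|: [set z in x :: s]) <= f (S :|: T).
  by apply: le_trans (f_le_WPPICDS wT F0) _; apply: f_le; apply: subsetUr.
have : \sum_(y in T) lam * gain S y <= #|T|%:R * (lam * gain S x).
  rewrite mulr_natl -sumr_const; apply: ler_sum => y _.
  rewrite ler_pM2l ?lam_gt0 //; case: (boolP (y \in S)) => [/gain_in ->|yS].
    exact: gain_ge0.
  by case: gs => _ _ ->.
rewrite -(ler_pM2l lam_gt0) in fT; move: fT; rewrite !mulrBr; lra.
Qed.

End Greedy.

(** * Logarithmic bound on the number of greedy steps *)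

Lemma ln_step (R : realType) (t a b : R) : 0 < t -> 0 < a -> 0 < b -> b <= a - a / t ->
  t * ln (b / t) + 1 <= t * ln (a / t).
Proof.
move=> t0 a0 b0 ba; rewrite !ln_div ?posrE //.
suff : t * (ln b - ln a) <= - 1 by lra.
have ba' : b / a - 1 <= - t^-1.
  by rewrite lerBlDr ler_pdivrMr //; lra.
(* The tangent bound for the logarithm at 1 turns the contraction into an additive decrease. *)
have : ln (b / a) <= b / a - 1.
  have := @le_ln1Dx R (b / a - 1); rewrite subrKC; apply.
  by rewrite ltrBrDr addNr divr_gt0.
rewrite ln_div ?posrE // => ln_ba.
have -> : - 1 = t * (- t^-1) by rewrite mulrN divff // gt_eqF.
by rewrite ler_pM2l //; lra.
Qed.

(** The logarithm is nonnegative only once [a] reaches [t], so the induction carries a separate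
    linear bound below that threshold. *)
Lemma greedy_size_log (R : realType) (V : finType) (e : rel V) (w : V -> V -> rat)
  (S : {set V}) (s : seq V) (T : {set V}) :
  symmetric e -> irreflexive e -> pos_sym_weights e w -> graph_connected e ->
  (1 < #|V|)%N -> is_WPPICDS e w T -> greedy_from e w S s ->
  let t : R := #|T|%:R in
  let a : R := ratr ((Lmax e w)%:R * (f e w (S :|: [set z in s]) - f e w S)
                     - (#|T|%:R - 1)) in
  if a < t then (size s)%:R <= 2 * t - 1 else (size s)%:R <= t * (2 + ln (a / t)).
Proof.
move=> eS eI wP ec V2 wT; have t1 : (1 <= #|T|)%N.
  by rewrite card_gt0; apply: (WPPICDS_neq0 wP ec V2 wT).
set t : R := #|T|%:R; have {}t1 : 1 <= t by rewrite /t ler1n.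
have log_ge0 a : t <= a -> 0 <= t * ln (a / t).
  by move=> ta; rewrite mulr_ge0 ?ln_ge0 //; rewrite ler_pdivlMr; lra.
elim: s S => [|x s IHs] S gs /=.
  case: ltP => [_|ta]; first by lra.
  by have := log_ge0 _ ta; lra.
have size_le := greedy_size_le eS eI wP ec V2 gs.
have step := greedy_step_progress eS eI wP ec V2 wT gs.
set a := ratr _; case: ltP => ta.
  move: size_le; rewrite -(ler_rat R) !ratr_nat => size_le.
  have {}size_le : (size s).+1%:R <= a + t - 1.
    by apply: le_trans size_le _; rewrite /a /t rmorphB rmorphB /= ratr_nat rmorph1; lra.
  by lra.
have [_ _ _ gs'] := gs.
have := IHs _ gs'; rewrite -greedy_final_cons.
set b := ratr _.
have ab : b <= a - a / t.
  rewrite -(ler_rat R) in step; rewrite -/a rmorphM /= ratr_nat -/t in step.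
  have -> : b = a - ratr ((Lmax e w)%:R * gain e w S x).
    by rewrite /b /a -rmorphB; congr ratr; rewrite /gain !mulrBr; lra.
  by rewrite lerB // ler_pdivrMr; [rewrite mulrC|lra].
move=> /=; case: (ltP b t) => tb IH.
  (* The potential crosses [t] at this step: it and the at most [2 * t - 1] later ones make
     [2 * t]. *)
  by rewrite -natr1; have := log_ge0 _ ta; lra.
have := @ln_step _ t a b; rewrite -natr1; lra.
Qed.

Theorem mainTheorem20 (R : realType) (V : finType) (e : rel V) (w : V -> V -> rat) :
  simple_graph e -> pos_sym_weights e w -> graph_connected e -> (1 < #|V|)%N ->
  forall S : {set V}, greedy_output e w S ->
  is_WPPICDS e w S /\
  forall Sstar : {set V}, min_WPPICDS e w Sstar ->
    (#|S|%:R : R) <=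
      (2 + ln (ratr (3%:R / 2%:R) * (Lmax e w)%:R * ratr (Wmax e w)
               + (Delta e)%:R)) * (#|Sstar|%:R).
Proof.
move=> [eS eI] wP ec V2 S [s [gs ->]].
have := greedy_from_WPPICDS eS eI wP ec V2 gs; rewrite set0U => wS.
split=> // T [wT _].
have T0 := WPPICDS_neq0 wP ec V2 wT.
have /card_gt0P[v _] : (0 < #|V|)%N by apply: leq_trans V2.
have := @greedy_size_log R V e w set0 s T eS eI wP ec V2 wT gs; rewrite set0U /=.
set t : R := #|T|%:R; set a := ratr _.
have t1 : 1 <= t by rewrite /t ler1n card_gt0.
have lam0 := @lam_gt0 _ e w V2.
pose B : rat := 3 / 2 * (Lmax e w)%:R * Wmax e w + (Delta e)%:R.
have -> : ratr (3 / 2) * (Lmax e w)%:R * ratr (Wmax e w) + (Delta e)%:R = ratr B :> R.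
  by rewrite /B rmorphD !rmorphM /= !ratr_nat.
have W0 : 0 <= Wmax e w by apply: le_trans (Wv_le_Wmax e w v); apply: WA_ge0.
(* Some vertex has a neighbour, so [Delta] is at least 1; this makes [ln (ratr B)] nonnegative in
   the case [a < t]. *)
have B1 : 1 <= ratr B :> R.
  rewrite -(rmorph1 (@ratr R)) ler_rat /B.
  apply: ler_wpDl; first by rewrite !mulr_ge0 // ltW.
  rewrite ler1n; have [z evz] := neighbour_exists ec V2 v.
  apply: leq_trans (leq_bigmax v); apply/card_gt0P; exists z.
  by rewrite inE.
(* From the empty set every scaled gain is at most [B], and the defect [#|T| - 1] cancels against
   the term subtracted in [a]. *)
have aB : a <= t * ratr B.
  rewrite /a (_ : t = ratr #|T|%:R) -?rmorphM ?ler_rat; last by rewrite ratr_nat.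
  have := f_setU_connected_le eS eI wP ec V2 set0 wT.2 T0; rewrite set0U.
  have sz := WPPICDS_neq0 wP ec V2 wS.
  have := f_le_WPPICDS eS wP ec V2 wT sz; rewrite -(ler_pM2l lam0).
  have : \sum_(y in T) (Lmax e w)%:R * gain e w set0 y <= #|T|%:R * B.
    rewrite mulr_natl -sumr_const; apply: ler_sum => y _.
    rewrite (lam_gain e w V2) setU0 (h_set0 wP) cN_set0 2!subr0.
    apply: lerD; last first.
      apply: le_trans (cN_set1 eS eI y) _; rewrite ler_nat.
      exact: (leq_bigmax y).
    rewrite [3 / 2 * _]mulrC -mulrA ler_pM2l //.
    exact: h_set1.
  by rewrite mulrBr; clearbody B; clear; lra.
have sz : #|[set z in s]|%:R <= (size s)%:R :> R by rewrite ler_nat cardsE card_size.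
clearbody a B t => {gs wS T0 wT lam0 W0}.
have t0 : 0 < t by apply: lt_le_trans t1.
case: ltP => ta le; apply: le_trans sz _; apply: le_trans le _; rewrite [leRHS]mulrC.
  have : 0 <= t * ln (ratr B) by rewrite mulr_ge0 ?ln_ge0 // ltW.
  by lra.
rewrite ler_pM2l // lerD2l ler_ln ?posrE.
- by rewrite ler_pdivrMr // mulrC.
- by rewrite divr_gt0 // (lt_le_trans t0 ta).
- exact: lt_le_trans B1.
Qed.
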